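(* Let $X,X_1,\ldots,X_n\in\mathbb{R}^p$ be i.i.d. random vectors with covariance matrix $\Sigma=\operatorname{Var}(X)$, whose largest eigenvalue is $\lambda_1$, and suppose $X$ is sub-Gaussian in the sense that there are constants $K,C>0$ with \[ \mathbb{P}\bigl(|v^T(X-\mathbb{E}X)|\ge t\bigr)\le K\exp\bigl[-Ct^2/(v^T\Sigma v)\bigr]\quad\text{for all } v\ne 0,\ t>0. \] Assume $\log p\le n$. Let $S=\frac1n\sum_{i=1}^n(X_i-\bar X)(X_i-\bar X)^T$ with $\bar X=\frac1n\sum_{i=1}^nX_i$. Fix $k$ with $1\le k\le p$ and $R>0$, and let \[ H_R\in\arg\max_{H\in\mathcal{F}^k,\ \lVert H\rVert_{1,1}\le R}\langle\Sigma,H\rangle,\qquad \widehat H_R\in\arg\max_{H\in\mathcal{F}^k,\ \lVert H\rVert_{1,1}\le R}\langle S,H\rangle . \] Then there is a constant $c>0$ such that, with probability at least $1-2p^{-2}$, \[ \langle\Sigma,H_R\rangle\ \ge\ \langle\Sigma,\widehat H_R\rangle\ \ge\ \langle\Sigma,H_R\rangle-cR\lambda_1\sqrt{\frac{\log p}{n}}. \]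
   Context: $\mathcal{F}^k=\{H\in\mathbb{R}^{p\times p}\text{ symmetric}: 0\preceq H\preceq I,\ \operatorname{trace}(H)=k\}$ is the trace-$k$ Fantope. $\langle A,B\rangle=\operatorname{trace}(A^TB)$ and $\lVert H\rVert_{1,1}=\sum_{i,j}|H_{ij}|$. *)

(* Defs.v *)
From HB Require Import structures.
From mathcomp Require Import all_boot all_order all_algebra.
From mathcomp Require Import all_classical all_reals all_analysis.
Set Implicit Arguments. Unset Strict Implicit. Unset Printing Implicit Defensive.
Import Order.TTheory GRing.Theory Num.Theory.
Local Open Scope ring_scope.
Local Open Scope classical_set_scope.

Definition frob (R : realType) (p : nat) (A B : 'M[R]_p) : R := \tr (A^T *m B).

Definition norm11 (R : realType) (p : nat) (H : 'M[R]_p) : R :=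
  \sum_(i < p) \sum_(j < p) `|H i j|.

Definition psd (R : realType) (p : nat) (A : 'M[R]_p) : Prop :=
  forall v : 'cV[R]_p, 0 <= (v^T *m A *m v) 0 0.

Definition fantope (R : realType) (p k : nat) (H : 'M[R]_p) : Prop :=
  H^T = H /\ psd H /\ psd (1%:M - H) /\ \tr H = k%:R.

Definition feasible (R : realType) (p k : nat) (Rad : R) (H : 'M[R]_p) : Prop :=
  fantope k H /\ norm11 H <= Rad.

Definition is_argmax (R : realType) (p k : nat) (Rad : R) (A H : 'M[R]_p) : Prop :=
  feasible k Rad H /\ forall H', feasible k Rad H' -> frob A H' <= frob A H.

Definition mean_vec d (T : measurableType d) (R : realType) (P : probability T R)
  (p : nat) (X : T -> 'cV[R]_p) : 'cV[R]_p :=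
  \col_(j < p) fine ('E_P[fun w => X w j ord0])%E.

Definition cov_mat d (T : measurableType d) (R : realType) (P : probability T R)
  (p : nat) (X : T -> 'cV[R]_p) : 'M[R]_p :=
  \matrix_(j < p, l < p) fine (covariance P (fun w => X w j 0) (fun w => X w l 0)).

(* coordinates of X have finite second moments (this includes measurability) *)
Definition L2_vec d (T : measurableType d) (R : realType) (P : probability T R)
  (p : nat) (X : T -> 'cV[R]_p) : Prop :=
  forall j : 'I_p, (fun w => X w j 0) \in Lfun P 2%:E.

Definition box_event d (T : measurableType d) (R : realType) (p : nat)
  (X : T -> 'cV[R]_p) (B : 'I_p -> set R) : set T :=
  [set w | forall j, B j (X w j 0)].

(* mutual independence of X_1..X_n, tested on measurable boxes (a pi-system
   generating the Borel sigma-algebra of R^p); taking B_i = setT for some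
   i gives the product rule for every subfamily. *)
Definition mutually_independent d (T : measurableType d) (R : realType)
  (P : probability T R) (p n : nat) (Xs : 'I_n -> T -> 'cV[R]_p) : Prop :=
  forall B : 'I_n -> 'I_p -> set R, (forall i j, measurable (B i j)) ->
    P (\bigcap_(i in [set: 'I_n]) box_event (Xs i) (B i))
    = (\prod_(i < n) P (box_event (Xs i) (B i)))%E.

Definition same_law d (T : measurableType d) (R : realType)
  (P : probability T R) (p : nat) (X Y : T -> 'cV[R]_p) : Prop :=
  forall B : 'I_p -> set R, (forall j, measurable (B j)) ->
    P (box_event X B) = P (box_event Y B).

Definition sample_mean (R : realType) (p n : nat) (x : 'I_n -> 'cV[R]_p) : 'cV[R]_p :=
  n%:R^-1 *: \sum_(i < n) x i.

Definition sample_cov (R : realType) (p n : nat) (x : 'I_n -> 'cV[R]_p) : 'M[R]_p :=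
  n%:R^-1 *: \sum_(i < n) ((x i - sample_mean x) *m (x i - sample_mean x)^T).

(* Main.v *)
Require Import Defs.
From HB Require Import structures.
From mathcomp Require Import all_boot all_order all_algebra.
From mathcomp Require Import all_classical all_reals all_analysis.
From mathcomp Require Import measurable_realfun ring lra.
Set Implicit Arguments. Unset Strict Implicit. Unset Printing Implicit Defensive.
Import Order.TTheory GRing.Theory Num.Theory.
Local Open Scope ring_scope.
Local Open Scope classical_set_scope.

(** By duality between the entrywise [l1] and [l_oo] norms, the error of the
    empirical maximiser is at most [2 Rad |S - Sigma|_oo], so it is enough to
    bound [|S - Sigma|_oo] by [O(l1 sqrt (ln p / n))] with probability
    [1 - 2 / p ^ 2]. Since [Sigma_jj <= l1], the sub-Gaussian tail makes
    [expR (C Y_j ^ 2 / (2 l1))] integrable for each centered coordinate [Y_j],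
    with a bound depending only on [K] and [C]. Hence [Y_j] and [Y_j Y_l - Sigma_jl],
    suitably scaled, have exponential moments, and Bernstein's argument (the moment
    generating function of an independent sum at [sqrt (ln p / n) / 2]) gives
    deviations of the empirical means with probability [O(p ^ -5)]; a union bound
    over the [p ^ 2] entries concludes. *)

(** * Independence and products of integrals *)

Section density.
Local Open Scope ereal_scope.
Context d (T : measurableType d) (R : realType) (mu : {finite_measure set T -> \bar R}).
Variables (h : T -> \bar R).
Hypotheses (h0 : forall x, 0 <= h x) (ih : mu.-integrable setT h).

(* The proof arguments let canonical structures find the measure instances below. *)
Definition density_of (_ : forall x, 0 <= h x) (_ : mu.-integrable setT h) (A : set T) :=
  \int[mu]_(x in A) h x.

Local Notation nu := (density_of h0 ih).

Let nu_set0 : nu set0 = 0. Proof. exact: integral_set0. Qed.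

Let nu_ge0 A : 0 <= nu A. Proof. exact: integral_ge0. Qed.

Let nu_sigma : semi_sigma_additive nu.
Proof. exact/semi_sigma_additive_nng_induced/h0/(measurable_int _ ih). Qed.

HB.instance Definition _ := isMeasure.Build _ _ _ nu nu_set0 nu_ge0 nu_sigma.

Let nu_fin : fin_num_fun nu.
Proof.
move=> A mA; apply: integrable_fin_num => //.
exact: integrableS ih.
Qed.

HB.instance Definition _ := Measure_isFinite.Build _ _ _ nu nu_fin.

(** The change of variables holds with the Radon-Nikodym derivative of [nu], and that derivative
    equals [h] almost everywhere because both have integral [nu E] over every measurable [E]. *)
Lemma integral_density (g : T -> \bar R) : (forall x, 0 <= g x) -> measurable_fun [set: _] g ->
  \int[nu]_x g x = \int[mu]_x (g x * h x).
Proof.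
move=> g0 mg.
have numu : nu `<< mu.
  apply/null_content_dominatesP => A mA muA0.
  exact: null_set_integral (measurable_funTS (measurable_int _ ih)) _.
rewrite -(Radon_Nikodym_SigmaFinite.change_of_variables numu)//.
have mf := measurable_int _ (Radon_Nikodym_SigmaFinite.f_integrable numu).
apply: ae_eq_integral => //.
- exact: emeasurable_funM.
- apply: emeasurable_funM => //; exact: measurable_int ih.
- apply: ae_eqe_mul2l; apply: integral_ae_eq => //.
  + exact: Radon_Nikodym_SigmaFinite.f_integrable.
  + exact: measurable_int ih.
  + by move=> E _ mE; rewrite -Radon_Nikodym_SigmaFinite.f_integral.
Qed.

End density.

(** Measurable rectangles are stable under intersection, contain the whole space and generate the
    product sigma-algebra, so the uniqueness theorem for finite measures applies. *)
Lemma measure_unique_rectangles d1 d2 (T1 : measurableType d1) (T2 : measurableType d2)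
    (R : realType) (m1 m2 : {measure set (T1 * T2) -> \bar R}) :
  (m1 setT < +oo)%E ->
  (forall A B, measurable A -> measurable B -> m1 (A `*` B) = m2 (A `*` B)) ->
  forall E, measurable E -> m1 E = m2 E.
Proof.
move=> m1oo m12 E mE.
apply: (measure_unique [set C | exists2 A, measurable A & exists2 B, measurable B & A `*` B = C]
  (fun=> setT)) => //.
- by rewrite measurable_prod_measurableType.
- move=> _ _ [A1 mA1 [B1 mB1 <-]] [A2 mA2 [B2 mB2 <-]]; rewrite -setXI.
  exists (A1 `&` A2); first exact: measurableI.
  by exists (B1 `&` B2) => //; exact: measurableI.
- by move=> _; exists setT => //; exists setT => //; rewrite setXTT.
- exact: bigcup_const.
- by move=> _ [A mA [B mB <-]]; exact: m12.
Qed.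

Lemma emeasurable_fun_prod d (T : measurableType d) (R : realType) (I : Type) (s : seq I)
    (p : pred I) (D : set T) (f : I -> T -> \bar R) :
  (forall i, p i -> measurable_fun D (f i)) ->
  measurable_fun D (fun x => \prod_(i <- s | p i) f i x)%E.
Proof.
move=> mf; elim: s => [|i s IH].
  by under eq_fun do rewrite big_nil; exact: measurable_cst.
under eq_fun do rewrite big_cons.
by case pi : (p i) => //; apply: emeasurable_funM => //; exact: mf.
Qed.

Section independence.
Local Open Scope ereal_scope.
Context d d1 d2 (T : measurableType d) (T1 : measurableType d1) (T2 : measurableType d2).
Context (R : realType) (P : probability T R).

(** The law of [f] under the density [h] and [c] times its law under [P] agree on rectangles by
    hypothesis, hence everywhere; integrating [g] against both gives the claim. *)
Lemma integral_mul_rectangles (h : T -> \bar R) (f : {mfun T >-> (T1 * T2)%type}) (c : \bar R)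
    (g : T1 * T2 -> \bar R) :
  (forall x, 0 <= h x) -> P.-integrable setT h ->
  0 <= c -> c \is a fin_num ->
  (forall A B, measurable A -> measurable B ->
    \int[P]_x (h x * (\1_(A `*` B) (f x))%:E) = c * P (f @^-1` (A `*` B))) ->
  (forall y, 0 <= g y) -> measurable_fun [set: T1 * T2] g ->
  \int[P]_x (h x * g (f x)) = c * \int[P]_x g (f x).
Proof.
move=> h0 ih c0 cfin hrect g0 mg.
have c0' : (0 <= fine c)%R by exact: fine_ge0.
pose m1 : {measure set _ -> \bar R} := pushforward (density_of h0 ih) f.
pose m2 : {measure set _ -> \bar R} := mscale (NngNum c0') (pushforward P f).
have mf : measurable_fun [set: T] f by [].
have m12 E : measurable E -> m1 mf E = m2 mf E.
  apply: measure_unique_rectangles => [|A B mA mB].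
    by rewrite /m1/= /pushforward preimage_setT -ge0_fin_numE// fin_num_measure.
  transitivity ((fine c)%:E * P (f @^-1` (A `*` B))); last by [].
  rewrite fineK// -hrect// /m1/= /pushforward /density_of.
  rewrite integral_mkcond; apply: eq_integral => x _.
  by rewrite epatch_indic.
have : \int[m1 mf]_y g y = \int[m2 mf]_y g y.
  by apply: eq_measure_integral => E mE _; rewrite m12.
rewrite ge0_integral_mscale//= fineK// !ge0_integral_pushforward//.
rewrite integral_density//; last exact: measurableT_comp.
  by rewrite preimage_setT => <-; apply: eq_integral => x _; rewrite muleC.
by move=> x; exact: g0.
Qed.

Lemma integral_prod_independent n (f : 'I_n -> {mfun T >-> (T1 * T2)%type}) :
  (forall A B, (forall i, measurable (A i)) -> (forall i, measurable (B i)) ->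
    P (\bigcap_(i in [set: 'I_n]) f i @^-1` (A i `*` B i)) =
    \prod_(i < n) P (f i @^-1` (A i `*` B i))) ->
  forall g : 'I_n -> T1 * T2 -> \bar R,
  (forall i y, 0 <= g i y) -> (forall i, measurable_fun [set: T1 * T2] (g i)) ->
  (forall i, \int[P]_x g i (f i x) < +oo) ->
  \int[P]_x (\prod_(i < n) g i (f i x)) = \prod_(i < n) \int[P]_x g i (f i x).
Proof.
move=> indep.
(* Replace the rectangle indicators by the functions [g i] one index at a time. *)
suff H m : forall g : 'I_n -> T1 * T2 -> \bar R,
  (forall i y, 0 <= g i y) -> (forall i, measurable_fun [set: T1 * T2] (g i)) ->
  (forall i, \int[P]_x g i (f i x) < +oo) ->
  (forall i : 'I_n, (m <= i)%N -> exists AB : set T1 * set T2,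
    [/\ measurable AB.1, measurable AB.2 & g i = EFin \o \1_(AB.1 `*` AB.2)]) ->
  \int[P]_x (\prod_(i < n) g i (f i x)) = \prod_(i < n) \int[P]_x g i (f i x).
  by move=> g g0 mg gfin; apply: (H n) => // i; rewrite leqNgt ltn_ord.
(* [m] counts the leading indices whose factor is arbitrary. At [m = 0] every factor is a rectangle
   indicator, their product is the indicator of the intersection, and independence applies; at
   [m = n] the restriction is vacuous. *)
elim: m => [|m IH] g g0 mg gfin grect.
  have [AB ABP] := choice (fun i => grect i isT).
  transitivity (P (\bigcap_(i in [set: 'I_n]) f i @^-1` ((AB i).1 `*` (AB i).2))).
    rewrite -[in RHS](setIT (\bigcap_(_ in _) _)) -integral_indic//.
      apply: eq_integral => x _.
      rewrite indicE; have [/set_mem xE|/negP xE] := boolP (_ \in _).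
        apply: big1 => i _; have [_ _ ->] := ABP i; rewrite /= indicE mem_set//.
        exact: xE.
      have [i xi] : exists i, ~ ((AB i).1 `*` (AB i).2) (f i x).
        by apply/existsNP => H; apply: xE; apply/mem_set => i _; exact: H.
      rewrite (bigD1 i)//=; have [_ _ ->] := ABP i.
      by rewrite /= indicE memNset// mul0e.
    apply: fin_bigcap_measurable => // i _.
    rewrite -[X in measurable X]setTI; apply: measurable_funP => //.
    by have [? ? _] := ABP i; exact: measurableX.
  rewrite (indep (fun i => (AB i).1) (fun i => (AB i).2))//; [|by move=> i; case: (ABP i)..].
  apply: eq_bigr => i _; have [? ? ->] := ABP i.
  rewrite -[in LHS](setIT (_ @^-1` _)) -integral_indic//.
  by rewrite -[X in measurable X]setTI; apply: measurable_funP => //; exact: measurableX.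
have [nm|mn] := leqP n m.
  by apply: IH => // i mi; have := leq_trans nm mi; rewrite leqNgt ltn_ord.
pose i0 := Ordinal mn.
(* With a rectangle indicator put at index [i0], the induction hypothesis becomes the rectangle
   identity required by [integral_mul_rectangles], the density being the product of the other
   factors. *)
have IHE A B : measurable A -> measurable B ->
    \int[P]_x ((\prod_(i < n | i != i0) g i (f i x)) * (\1_(A `*` B) (f i0 x))%:E) =
    (\prod_(i < n | i != i0) \int[P]_x g i (f i x)) * P (f i0 @^-1` (A `*` B)).
  move=> mA mB.
  pose g' i := if i == i0 then EFin \o \1_(A `*` B) else g i.
  have g'i0 : g' i0 = EFin \o \1_(A `*` B) by rewrite /g' eqxx.
  have g'N i : i != i0 -> g' i = g i by rewrite /g' => /negbTE ->.
  have g'int : \int[P]_x (g' i0 (f i0 x)) = P (f i0 @^-1` (A `*` B)).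
    rewrite g'i0 -[in RHS](setIT (_ @^-1` _)) -integral_indic//.
    by rewrite -[X in measurable X]setTI; apply: measurable_funP => //; exact: measurableX.
  have g'intN : \prod_(i < n | i != i0) \int[P]_x g' i (f i x) =
      \prod_(i < n | i != i0) \int[P]_x g i (f i x).
    by apply: eq_bigr => i /g'N ->.
  have := IH g'; rewrite (bigD1 i0)//= g'int muleC g'intN => <-.
  - apply: eq_integral => x _; rewrite [RHS](bigD1 i0)//= g'i0 muleC; congr (_ * _).
    by apply: eq_bigr => i /g'N ->.
  - move=> i y; rewrite /g'; case: ifP => // _; by rewrite lee_fin.
  - move=> i; rewrite /g'; case: ifP => // _; apply/measurable_EFinP.
    by apply: measurable_indic; exact: measurableX.
  - move=> i; have [->|ii0] := eqVneq i i0; last by rewrite g'N.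
    rewrite g'int (le_lt_trans (probability_le1 _ _))// ?ltry// -[X in measurable X]setTI.
    by apply: measurable_funP => //; exact: measurableX.
  - move=> i mi; have [->|ii0] := eqVneq i i0; first by exists (A, B).
    rewrite g'N//; apply: grect; rewrite ltn_neqAle mi andbT.
    by apply: contra ii0 => /eqP mi'; apply/eqP/val_inj.
rewrite (bigD1 i0)//= muleC.
have c0 : 0 <= \prod_(i < n | i != i0) \int[P]_x g i (f i x).
  by apply: prode_ge0 => i _; apply: integral_ge0.
have cfin : \prod_(i < n | i != i0) \int[P]_x g i (f i x) \is a fin_num.
  by apply: prode_fin_num => i _; rewrite ge0_fin_numE ?integral_ge0.
rewrite -(integral_mul_rectangles (h := fun x => \prod_(i < n | i != i0) g i (f i x)))//.
- by apply: eq_integral => x _; rewrite (bigD1 i0)//= muleC.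
- by move=> x; apply: prode_ge0.
- apply/integrableP; split.
    by apply: emeasurable_fun_prod => i _; exact: measurableT_comp.
  under eq_integral do rewrite gee0_abs ?prode_ge0//.
  (* Taking the whole space as rectangle computes the integral of the other factors, a finite
     product of finite integrals. *)
  have := IHE _ _ measurableT measurableT.
  rewrite setXTT preimage_setT probability_setT mule1 => hE.
  rewrite [ltLHS](_ : _ = \prod_(i < n | i != i0) \int[P]_x g i (f i x)) -?ge0_fin_numE//.
  by rewrite -hE; apply: eq_integral => x _; rewrite indicE in_setT mule1.
Qed.

End independence.

(** * Exponential moments and tails of independent sums *)

Section expR_bounds.
Context (R : realType).
Implicit Types x s w : R.

(** The bound [1 + y <= expR y] at [y = - x] gives [expR x - 1 <= x * expR x]. The remainder is then
    at most [x * (expR x - 1)], which is estimated separately for each sign of [x]. *)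
Lemma expR_le_quadratic x : expR x <= 1 + x + x ^+ 2 * expR `|x|.
Proof.
have inv : expR x * expR (- x) = 1 by rewrite -expRD subrr expR0.
have e1 := expR_ge1Dx x; have e2 := expR_ge1Dx (- x).
have e0 := expR_gt0 x.
have [x0|x0] := leP 0 x.
  have le1 : expR x - 1 <= x * expR x by nra.
  by rewrite ger0_norm// expr2; nra.
rewrite ltr0_norm//.
have le1 : expR x - 1 <= x * expR x by nra.
have le2 : 1 <= expR (- x) by rewrite -expR0 ler_expR oppr_ge0 ltW.
by rewrite expr2; nra.
Qed.

(** This is [y ^+ 2 / 2 <= expR y] at half of the absolute value of [x], whence the constant 8. *)
Lemma sqr_le_expR x : x ^+ 2 <= 8 * expR (`|x| / 2).
Proof.
have x2 : 0 <= `|x| / 2 by rewrite divr_ge0.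
have := expR_ge1Dxn 1 x2.
by rewrite exprMn -normrX (ger0_norm (sqr_ge0 x)) (_ : 2`! = 2)%N//; lra.
Qed.

(** In the quadratic bound at [s * w], the factor [w ^+ 2] uses up one half of the exponent and the
    exponential of [s * w] the other half. *)
Lemma expR_scale_le s w : `|s| <= 1 / 2 ->
  expR (s * w) <= 1 + s * w + 8 * s ^+ 2 * expR `|w|.
Proof.
move=> s2; apply: (le_trans (expR_le_quadratic _)); rewrite lerD2l exprMn.
rewrite [8 * _]mulrC -(mulrA (s ^+ 2)) -[leRHS]mulrA ler_wpM2l ?sqr_ge0//.
have -> : expR `|w| = expR (`|w| / 2) * expR (`|w| / 2) by rewrite -expRD -splitr.
rewrite mulrA ler_pM ?sqr_ge0 ?expR_ge0 ?sqr_le_expR// ler_expR normrM.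
by rewrite mulrC ler_wpM2l// -[2^-1]mul1r.
Qed.

Lemma natr_le_expR_exp n : ((2 ^ n)%:R : R) <= expR n%:R.
Proof.
rewrite natrX -[in leRHS](mulr1 n%:R) expRM_natl lerXn2r ?nnegrE ?expR_ge0//.
by have := expR_ge1Dx (1 : R).
Qed.

End expR_bounds.

Section exponential_moments.
Context d (T : measurableType d) (R : realType) (P : probability T R).
Implicit Types (W Z : T -> R) (B K s : R).

(** Cutting at the integer part of [Z] bounds [expR Z] by the sum of [expR (m + 1)] over the [m]
    with [m <= Z]. The decay [expR (- 2 m)] of the tail leaves terms dominated by a geometric
    series. *)
Lemma integral_expR_tail Z K : measurable_fun [set: T] Z -> (forall x, 0 <= Z x) -> 0 <= K ->
  (forall m : nat, (0 < m)%N ->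
    P [set x | (m%:R <= Z x)%R] <= (K * expR (- (2 * m%:R)))%:E)%E ->
  (\int[P]_x (expR (Z x))%:E <= (2 * expR 1 * (1 + K))%:E)%E.
Proof.
move=> mZ Z0 K0 tail.
have mE m : measurable [set x | (m%:R : R) <= Z x].
  by rewrite -[X in measurable X]setTI; apply: measurable_fun_ler => //; exact: measurable_cst.
pose F (m : nat) x := ((expR (m.+1%:R : R))%:E * (\1_[set x | (m%:R <= Z x)%R] x)%:E)%E.
have F0 m x : (0 <= F m x)%E by rewrite mule_ge0// lee_fin ?expR_ge0.
have mF m : measurable_fun [set: T] (F m).
  by apply: emeasurable_funM => //; apply/measurable_EFinP; exact: measurable_indic.
apply: (@le_trans _ _ (\int[P]_x (\sum_(m <oo) F m x))%E).
  apply: ge0_le_integral => //.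
  - by apply/measurable_EFinP; exact: measurableT_comp.
  - exact: ge0_emeasurable_sum.
  move=> x _; apply: le_trans (nneseries_lim_ge (Num.truncn (Z x)).+1 _) => //.
  rewrite big_nat_recr//= -[leLHS]add0e leeD//; first exact: sume_ge0.
  rewrite /F indicE mem_set ?mule1 ?lee_fin ?ler_expR.
    by rewrite ltW// Num.Theory.truncnS_gt.
  by rewrite /= Num.Theory.truncn_le.
rewrite integral_nneseries//.
(* The bound is read as the sum of [eps / 2 ^ m.+1] with [eps = 2 * (expR 1 * (1 + K))], so that
   term [m] may be as large as [expR 1 * (1 + K) / 2 ^ m]. *)
have -> : 2 * expR 1 * (1 + K) = 2 * (expR 1 * (1 + K)) by rewrite mulrA.
apply: le_trans (epsilon_trick0 xpredT _) => //; last first.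
  by rewrite !mulr_ge0 ?expR_ge0// addr_ge0.
apply: lee_nneseries => [m _ _|m _]; first exact: integral_ge0.
rewrite ge0_integralZl//; last by apply/measurable_EFinP; exact: measurable_indic.
rewrite integral_indic// setIT.
have -> : 2 * (expR 1 * (1 + K)) / (2 ^ m.+1)%:R = expR 1 * (1 + K) / (2 ^ m)%:R.
  by rewrite expnS natrM; field; rewrite pnatr_eq0 expn_eq0.
(* The tail hypothesis starts at [m = 1]; the term [m = 0] uses only that a probability is at most
   1, which explains the 1 in [1 + K]. *)
case: m => [|m].
  apply: (@le_trans _ _ ((expR 1)%:E * 1)%E).
    by rewrite lee_pmul2l ?lte_fin ?expR_gt0// probability_le1.
  by rewrite mule1 lee_fin expn0 divr1 ler_peMr ?expR_ge0// lerDl.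
apply: (@le_trans _ _ ((expR m.+2%:R)%:E * (K * expR (- (2 * m.+1%:R)))%:E)%E).
  by rewrite lee_pmul2l ?lte_fin ?expR_gt0// tail.
rewrite -EFinM lee_fin.
rewrite mulrCA -expRD.
have -> : m.+2%:R + - (2 * m.+1%:R) = 1 - m.+1%:R :> R by rewrite -[m.+2%:R]natr1; ring.
rewrite expRD expRN [leLHS]mulrCA mulrA ler_pM//.
- by rewrite mulr_ge0// ?expR_ge0.
- by rewrite ler_wpM2l ?expR_ge0// lerDr.
- by rewrite lef_pV2 ?posrE ?expR_gt0 ?ltr0n ?expn_gt0// natr_le_expR_exp.
Qed.

Lemma integrable_of_expR_norm W B : measurable_fun [set: T] W ->
  (\int[P]_x (expR `|W x|)%:E <= B%:E)%E ->
  P.-integrable setT (fun x => (expR `|W x|)%:E) /\ P.-integrable setT (EFin \o W).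
Proof.
move=> mW iB.
have iexp : P.-integrable setT (fun x => (expR `|W x|)%:E).
  apply/integrableP; split.
    by apply/measurable_EFinP; apply: measurableT_comp => //; exact: measurableT_comp.
  under eq_integral do rewrite gee0_abs ?lee_fin ?expR_ge0//.
  exact: le_lt_trans iB (ltry _).
split=> //; apply: le_integrable iexp => //; first exact/measurable_EFinP.
move=> x _ /=; rewrite lee_fin [leRHS]ger0_norm ?expR_ge0//.
by apply: le_trans (expR_ge1Dx _); rewrite lerDr.
Qed.

(** Integrating [expR_scale_le] kills the linear term, as [W] has mean zero, and leaves
    [1 + 8 * B * s ^+ 2], at most the exponential claimed. *)
Lemma mgf_le W B s : measurable_fun [set: T] W ->
  (\int[P]_x (W x)%:E = 0)%E -> (\int[P]_x (expR `|W x|)%:E <= B%:E)%E -> `|s| <= 1 / 2 ->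
  (\int[P]_x (expR (s * W x))%:E <= (expR (8 * B * s ^+ 2))%:E)%E.
Proof.
move=> mW W0 iB s2; have [iexp iW] := integrable_of_expR_norm mW iB.
have isW : P.-integrable setT (fun x => (s%:E * (W x)%:E)%E) by exact: integrableZl.
have i1 : P.-integrable setT (cst (1%E : \bar R)) by exact: finite_measure_integrable_cst.
have i1W := integrableD measurableT i1 isW.
have ieW : P.-integrable setT (fun x => ((8 * s ^+ 2)%:E * (expR `|W x|)%:E)%E).
  exact: integrableZl.
have iall := integrableD measurableT i1W ieW.
apply: (@le_trans _ _ (1 + (8 * s ^+ 2)%:E * B%:E)%E); last first.
  rewrite -EFinM -EFinD lee_fin.
  by rewrite (_ : 8 * s ^+ 2 * B = 8 * B * s ^+ 2) ?expR_ge1Dx//; ring.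
have le1 x : ((expR (s * W x))%:E <=
    (cst (1%E : \bar R) \+ (fun x => (s%:E * (W x)%:E)%E) \+
     (fun x => ((8 * s ^+ 2)%:E * (expR `|W x|)%:E)%E)) x)%E.
  by rewrite /= -!EFinM -!EFinD lee_fin expR_scale_le.
have mexp : measurable_fun [set: T] (fun x => (expR (s * W x))%:E).
  have msW : measurable_fun [set: T] (fun x => s * W x).
    by apply: measurable_funM => //; exact: measurable_cst.
  by apply/measurable_EFinP; exact: (measurableT_comp (@measurable_expR R) msW).
have exp0 x : [set: T] x -> (0 <= (expR (s * W x))%:E)%E by rewrite lee_fin expR_ge0.
have miall := measurable_int _ iall.
apply: (le_trans (ge0_le_integral P measurableT exp0 mexp miall (fun x _ => le1 x))).
rewrite integralD// integralD// integral_cst//= probability_setT mule1.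
rewrite !integralZl//= W0 mule0 adde0 leeD2l// lee_wpmul2l// lee_fin.
by rewrite mulr_ge0 ?sqr_ge0.
Qed.

End exponential_moments.

Section independent_sums.
Context d d1 d2 (T : measurableType d) (T1 : measurableType d1) (T2 : measurableType d2).
Context (R : realType) (P : probability T R).
Variables (n : nat) (f : 'I_n -> {mfun T >-> (T1 * T2)%type}).
Hypothesis indep : forall A B, (forall i, measurable (A i)) -> (forall i, measurable (B i)) ->
  P (\bigcap_(i in [set: 'I_n]) f i @^-1` (A i `*` B i)) =
  (\prod_(i < n) P (f i @^-1` (A i `*` B i)))%E.

(** Chernoff's method: the indicator of the event is at most [expR (- (s * a))] times the product of
    the [expR (s * g)], whose integral factorises by independence. *)
Lemma sum_upper_tail (g : T1 * T2 -> R) (B s a : R) :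
  measurable_fun [set: T1 * T2] g ->
  (forall i, \int[P]_x (g (f i x))%:E = 0)%E ->
  (forall i, \int[P]_x (expR `|g (f i x)|)%:E <= B%:E)%E ->
  0 <= s -> s <= 1 / 2 ->
  (P [set x | (a <= \sum_(i < n) g (f i x))%R] <=
    (expR (n%:R * (8 * B * s ^+ 2) - s * a))%:E)%E.
Proof.
move=> mg g0 gB s0 s2.
have mgf i : measurable_fun [set: T] (fun x => g (f i x)) by exact: measurableT_comp.
have msum : measurable_fun [set: T] (fun x => \sum_(i < n) g (f i x)) by exact: measurable_sum.
have mE : measurable [set x | a <= \sum_(i < n) g (f i x)].
  by rewrite -[X in measurable X]setTI; apply: measurable_fun_ler => //; exact: measurable_cst.
have mexp : measurable_fun [set: T1 * T2] (fun y => (expR (s * g y))%:E).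
  have msg : measurable_fun [set: T1 * T2] (fun y => s * g y).
    by apply: measurable_funM => //; exact: measurable_cst.
  by apply/measurable_EFinP; exact: (measurableT_comp (@measurable_expR R) msg).
have mgf1 i : (\int[P]_x (expR (s * g (f i x)))%:E <= (expR (8 * B * s ^+ 2))%:E)%E.
  by apply: mgf_le => //; rewrite ger0_norm.
have mprod : measurable_fun [set: T] (fun x => \prod_(i < n) (expR (s * g (f i x)))%:E)%E.
  by apply: emeasurable_fun_prod => i _; exact: (measurableT_comp mexp).
rewrite -[X in P X]setIT -integral_indic//.
apply: (@le_trans _ _ (\int[P]_x ((expR (- (s * a)))%:E *
    \prod_(i < n) (expR (s * g (f i x)))%:E))%E).
  apply: ge0_le_integral => //.
  - by apply/measurable_EFinP; exact: measurable_indic.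
  - by apply: emeasurable_funM => //; exact: measurable_cst.
  move=> x _; rewrite prodEFin -expR_sum -EFinM -expRD lee_fin indicE.
  have [/set_mem xE|_] := boolP (_ \in _); last by rewrite expR_ge0.
  rewrite -[X in X%:R <= _]/1%N -expR0 ler_expR -mulr_sumr addrC -mulrBr.
  by rewrite mulr_ge0// subr_ge0.
rewrite ge0_integralZl ?lee_fin ?expR_ge0//; last first.
  by move=> x _; apply: prode_ge0 => i _; rewrite lee_fin expR_ge0.
rewrite (integral_prod_independent indep (g := fun _ y => (expR (s * g y))%:E))//; last first.
  by move=> i; apply: le_lt_trans (mgf1 i) (ltry _).
rewrite addrC expRD EFinM lee_pmul2l ?lte_fin ?expR_gt0// expRM_natl.
apply: (@le_trans _ _ (\prod_(i < n) (expR (8 * B * s ^+ 2))%:E)%E).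
  (* Nonnegativity is carried along, since multiplying inequalities of extended reals requires
     it. *)
  suff /andP[] : (0 <= \prod_(i < n) \int[P]_x (expR (s * g (f i x)))%:E <=
      \prod_(i < n) (expR (8 * B * s ^+ 2))%:E)%E by [].
  elim/big_ind2 : _ => [|x1 x2 y1 y2 /andP[x0 xx] /andP[y0 yy]|i _].
  - by rewrite lee01 lexx.
  - by rewrite mule_ge0//= lee_pmul.
  - by rewrite mgf1 integral_ge0// => x _; rewrite lee_fin expR_ge0.
by rewrite prodEFin prodr_const card_ord.
Qed.

Lemma sum_tail (g : T1 * T2 -> R) (B u : R) :
  measurable_fun [set: T1 * T2] g ->
  (forall i, \int[P]_x (g (f i x))%:E = 0)%E ->
  (forall i, \int[P]_x (expR `|g (f i x)|)%:E <= B%:E)%E ->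
  0 <= u -> u <= 1 ->
  (P [set x | (n%:R * (4 * B + 10) * u <= `|\sum_(i < n) g (f i x)|)%R] <=
    (2 * expR (- (5 * (n%:R * u ^+ 2))))%:E)%E.
Proof.
move=> mg g0 gB u0 u1.
have mgf i : measurable_fun [set: T] (fun x => g (f i x)) by exact: measurableT_comp.
have msum : measurable_fun [set: T] (fun x => \sum_(i < n) g (f i x)) by exact: measurable_sum.
set a := n%:R * (4 * B + 10) * u.
have mE (h : T -> R) : measurable_fun [set: T] h -> measurable [set x | a <= h x].
  move=> mh; rewrite -[X in measurable X]setTI; apply: measurable_fun_ler => //.
have -> : [set x | a <= `|\sum_(i < n) g (f i x)|] =
    [set x | a <= \sum_(i < n) g (f i x)] `|` [set x | a <= \sum_(i < n) - g (f i x)].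
  by apply/seteqP; split=> x /=; rewrite sumrN ler_normr => /orP.
(* Here [s = u / 2]: the moment bound costs [2 * B * n * u ^+ 2] and the threshold gains
   [(2 * B + 5) * n * u ^+ 2]. The surplus 5 later becomes the exponent in [p ^- 5]. *)
have -> : - (5 * (n%:R * u ^+ 2)) = n%:R * (8 * B * (u / 2) ^+ 2) - u / 2 * a.
  by rewrite /a; field.
have u2 : 0 <= u / 2 by rewrite divr_ge0.
have u12 : u / 2 <= 1 / 2 by rewrite ler_pM2r.
have mgN : measurable_fun [set: T1 * T2] (fun y => - g y) by exact: measurable_funN.
rewrite mulrDl mul1r EFinD.
apply: (le_trans (measureU2 P (mE _ msum) _)).
  by apply: mE; apply: measurable_sum => i; exact: measurable_funN.
apply: leeD; first exact: sum_upper_tail.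
apply: (sum_upper_tail (g := fun y => - g y)) => // i.
  under eq_integral do rewrite EFinN.
  have [_ ig] := integrable_of_expR_norm (mgf i) (gB i).
  by rewrite integralN ?g0 ?oppe0//; exact: (integrable_add_def measurableT ig).
by under eq_integral do rewrite normrN.
Qed.

End independent_sums.

(** * Rayleigh quotients and the deterministic perturbation bound *)

Section rayleigh.
Context (R : realType) (p : nat).
Implicit Types (A B : 'M[R]_p) (x y v : 'cV[R]_p).

Let bil A x y : R := (x^T *m A *m y) 0 0.
Let nrm x : R := (x^T *m x) 0 0.

Let bilE A x y : bil A x y = \sum_i \sum_j x i 0 * A i j * y j 0.
Proof.
rewrite /bil -mulmxA mxE; apply: eq_bigr => i _.
by rewrite !mxE mulr_sumr; apply: eq_bigr => j _; rewrite mulrA.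
Qed.

Let nrmE x : nrm x = \sum_i x i 0 ^+ 2.
Proof. by rewrite /nrm mxE; apply: eq_bigr => i _; rewrite mxE expr2. Qed.

Let nrm_ge0 x : 0 <= nrm x.
Proof. by rewrite nrmE sumr_ge0// => i _; exact: sqr_ge0. Qed.

Let sqr_le_nrm x i : x i 0 ^+ 2 <= nrm x.
Proof. by rewrite nrmE (bigD1 i)//= lerDl sumr_ge0// => j _; exact: sqr_ge0. Qed.

(** Each product of two coordinates of [x] is at most the mean of their squares, hence at most
    [nrm x]. *)
Let bil_le A x : bil A x x <= norm11 A * nrm x.
Proof.
rewrite bilE /norm11 mulr_suml ler_sum// => i _.
rewrite mulr_suml ler_sum// => j _.
apply: (le_trans (ler_norm _)); rewrite !normrM mulrAC mulrC mulrA -mulrA ler_wpM2l//.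
have := sqr_le_nrm x i; have := sqr_le_nrm x j.
rewrite -(real_normK (num_real (x i 0))) -(real_normK (num_real (x j 0))).
have := sqr_ge0 (`|x i 0| - `|x j 0|); rewrite !expr2; nra.
Qed.

Let bil_delta A j : bil A (delta_mx j 0) (delta_mx j 0) = A j j.
Proof. by rewrite /bil trmx_delta -rowE -colE !mxE. Qed.

Let nrm_delta (j : 'I_p) : nrm (delta_mx j 0) = 1.
Proof. by rewrite /nrm trmx_delta -rowE !mxE !eqxx. Qed.

(** Expand the nonnegative form at [x - c^-1 *: (invmx B *m x)]. The cross terms give
    [- 2 * c^-1 * nrm x], and the last term is at most [c^-1 * nrm x] because [c] exceeds the
    entrywise norm of the inverse; so [e = c^-1] works. *)
Let unit_psd_lower B : B^T = B -> (forall x, 0 <= bil B x x) -> B \in unitmx ->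
  exists2 e : R, 0 < e & forall x, e * nrm x <= bil B x x.
Proof.
move=> symB psdB uB; pose c := norm11 (invmx B) + 1.
have c0 : 0 < c.
  by rewrite ltr_wpDl// /norm11 sumr_ge0// => i _; rewrite sumr_ge0.
exists c^-1; first by rewrite invr_gt0.
move=> x; pose y := invmx B *m x.
have By : B *m y = x by rewrite /y mulKVmx.
have yB : y^T *m B = x^T by rewrite -[LHS]trmxK trmx_mul trmxK symB By.
have := psdB (x - c^-1 *: y).
have -> : bil B (x - c^-1 *: y) (x - c^-1 *: y) =
    bil B x x - 2 * c^-1 * nrm x + c^-1 ^+ 2 * bil (invmx B) x x.
  have xBy : bil B x y = nrm x by rewrite /bil /nrm -mulmxA By.
  have yBx : bil B y x = nrm x by rewrite /bil /nrm yB.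
  have yBy : bil B y y = bil (invmx B) x x by rewrite /bil yB /y mulmxA.
  rewrite -yBy.
  have -> : bil B (x - c^-1 *: y) (x - c^-1 *: y) =
     bil B x x - c^-1 * bil B x y - c^-1 * bil B y x + c^-1 ^+ 2 * bil B y y.
    have trE : (x - c^-1 *: y)^T = x^T - c^-1 *: y^T by rewrite linearB linearZ.
    rewrite /bil trE !mulmxBl !mulmxBr -!scalemxAl -!scalemxAr.
    by rewrite !mxE; ring.
  by rewrite yBx xBy; ring.
have le1 := bil_le (invmx B) x.
have le2 : c^-1 ^+ 2 * bil (invmx B) x x <= c^-1 * nrm x.
  rewrite expr2 -mulrA ler_pM2l ?invr_gt0// ler_pdivrMl//.
  by apply: (le_trans le1); rewrite ler_wpM2r// lerDl.
by move=> ?; nra.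
Qed.

(* The infimum of the [t] such that [t I - A] is positive semidefinite is an
   eigenvalue of [A]: otherwise [t I - A] would be invertible, and [t] could be
   decreased. *)
Lemma diag_le_eigenvalue A (l : R) : A^T = A -> (forall a, eigenvalue A a -> a <= l) ->
  forall j, A j j <= l.
Proof.
move=> symA ub j.
pose U := [set t : R | forall x, bil A x x <= t * nrm x].
have Ulb t : U t -> A j j <= t by move=> /(_ (delta_mx j 0)); rewrite bil_delta nrm_delta mulr1.
have U0 : U (norm11 A) by move=> x; exact: bil_le.
have hasU : has_inf U by split; [exists (norm11 A) | exists (A j j) => t /Ulb].
pose M := inf U.
(* The infimum is attained: for [nrm x > 0] the Rayleigh quotient of [x] is a lower bound of [U],
   and for [nrm x = 0] the constraint does not depend on [t]. *)
have UM : U M.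
  move=> x; have [x0|x0] := leP (nrm x) 0.
    have xe : nrm x = 0 by apply/eqP; rewrite eq_le x0 nrm_ge0.
    by have := U0 x; rewrite xe !mulr0.
  by rewrite -ler_pdivrMr//; apply: lb_le_inf => [|t Ut]; [case: hasU | rewrite ler_pdivrMr].
apply: le_trans (Ulb _ UM) _; apply: ub; apply: contrapT => notM.
pose B := M%:M - A.
have bilB x : bil B x x = M * nrm x - bil A x x.
  by rewrite /bil /nrm /B mulmxBr mulmxBl mul_mx_scalar -scalemxAl !mxE.
have symB : B^T = B by rewrite /B linearB/= tr_scalar_mx symA.
have uB : B \in unitmx.
  (* As [M] is assumed not to be an eigenvalue, [A - M%:M] has trivial kernel, and so has its
     opposite [B]. *)
  rewrite -row_free_unit -kermx_eq0; apply/eqP.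
  have : eigenspace A M = 0 by apply/eqP/negPn/negP => kN0; apply: notM.
  rewrite /eigenspace => k0; apply/eqP/rowV0P => v /sub_kermxP vB.
  have /sub_kermxP : v *m (A - M%:M) = 0 by rewrite -opprB mulmxN -/B vB oppr0.
  by rewrite k0 submx0 => /eqP.
have psdB x : 0 <= bil B x x by rewrite bilB subr_ge0; exact: UM.
have [e e0 He] := unit_psd_lower symB psdB uB.
have UMe : U (M - e) by move=> x; have := He x; rewrite bilB mulrBl lerBrDl addrC -lerBrDl.
by have := ge_inf hasU.2 UMe; rewrite -/M lerBrDl gerDr leNgt e0.
Qed.

End rayleigh.

Lemma frobE (R : realType) (p : nat) (A B : 'M[R]_p) :
  frob A B = \sum_i \sum_j A i j * B i j.
Proof.
rewrite exchange_big; apply: eq_bigr => j _.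
by rewrite mxE; apply: eq_bigr => i _; rewrite mxE.
Qed.

(** Duality of the entrywise sup norm and [norm11]. *)
Lemma frob_le (R : realType) (p : nat) (A B : 'M[R]_p) (e : R) :
  (forall i j, `|A i j| <= e) -> `|frob A B| <= e * norm11 B.
Proof.
move=> Ae; rewrite frobE (le_trans (ler_norm_sum _ _ _))// mulr_sumr ler_sum// => i _.
rewrite (le_trans (ler_norm_sum _ _ _))// mulr_sumr ler_sum// => j _.
by rewrite normrM ler_wpM2r.
Qed.

(** Optimality of [H'] for [A'] is tested against [H]; replacing [A'] by [A] costs at most [e * Rad]
    on each side. *)
Lemma argmax_perturbation (R : realType) (p k : nat) (Rad e : R) (A A' H H' : 'M[R]_p) :
  0 <= e -> (forall i j, `|(A' - A) i j| <= e) ->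
  is_argmax k Rad A H -> is_argmax k Rad A' H' ->
  frob A H - 2 * e * Rad <= frob A H'.
Proof.
move=> e0 AA' [[fH nH] maxH] [[fH' nH'] maxH'].
have frobB X : frob A' X = frob A X + frob (A' - A) X.
  by rewrite /frob linearB/= mulmxBl linearB/= addrC subrK.
have bnd X : norm11 X <= Rad -> `|frob (A' - A) X| <= e * Rad.
  by move=> nX; rewrite (le_trans (frob_le _ AA'))// ler_wpM2l.
have := maxH' H (conj fH nH); rewrite !frobB.
have := bnd _ nH; have := bnd _ nH'; rewrite !ler_norml => /andP[? ?] /andP[? ?] ?; lra.
Qed.

(** The sample covariance is invariant under translation, so it may be centered at any [m]. With [m]
    the true mean, it is expressed through averages of independent terms. *)
Lemma sample_covE (R : realType) (p n : nat) (x : 'I_n -> 'cV[R]_p) (m : 'cV[R]_p) j l :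
  (0 < n)%N ->
  sample_cov x j l =
    n%:R^-1 * (\sum_i (x i j 0 - m j 0) * (x i l 0 - m l 0)) -
    (n%:R^-1 * \sum_i (x i j 0 - m j 0)) * (n%:R^-1 * \sum_i (x i l 0 - m l 0)).
Proof.
move=> n0; have n0' : n%:R != 0 :> R by rewrite pnatr_eq0 -lt0n.
pose y i k := x i k 0 - m k 0.
pose ybar k := n%:R^-1 * \sum_i y i k.
have meanE k : sample_mean x k 0 = m k 0 + ybar k.
  rewrite /sample_mean mxE summxE /ybar /y sumrB mulrBr sumr_const card_ord.
  by rewrite -[m k 0 *+ n]mulr_natl mulKf// addrC subrK.
have sy k : \sum_i y i k = n%:R * ybar k by rewrite /ybar mulVKf.
transitivity (n%:R^-1 * (\sum_i y i j * y i l) - ybar j * ybar l); last by [].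
rewrite /sample_cov mxE summxE.
have -> : \sum_i ((x i - sample_mean x) *m (x i - sample_mean x)^T) j l =
    \sum_i (y i j * y i l - ybar j * y i l - ybar l * y i j + ybar j * ybar l).
  apply: eq_bigr => i _; rewrite mxE big_ord1 !mxE.
  by have := meanE j; have := meanE l; rewrite !mxE => -> ->; rewrite /y; ring.
move: ybar sy {meanE} => ybar sy.
rewrite big_split/= !sumrB sumr_const card_ord -!mulr_sumr !sy.
by rewrite -(mulr_natl (_ * _) n); field.
Qed.

(** * Random vectors and sample covariance *)

Section equal_laws.
Local Open Scope ereal_scope.
Context d d1 d2 (T : measurableType d) (T1 : measurableType d1) (T2 : measurableType d2).
Context (R : realType) (P : probability T R) (f f' : {mfun T >-> (T1 * T2)%type}).
Hypothesis ff' : forall A B, measurable A -> measurable B ->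
  P (f @^-1` (A `*` B)) = P (f' @^-1` (A `*` B)).

Let distrE E : measurable E -> distribution P f E = distribution P f' E.
Proof.
apply: measure_unique_rectangles => [|A B mA mB]; last exact: ff'.
by rewrite (le_lt_trans (probability_le1 _ _))// ltry.
Qed.

Lemma ge0_integral_equal_laws (g : T1 * T2 -> \bar R) :
  (forall y, 0 <= g y) -> measurable_fun [set: T1 * T2] g ->
  \int[P]_x g (f x) = \int[P]_x g (f' x).
Proof.
move=> g0 mg; have := @ge0_integral_distribution _ _ _ _ _ P f g mg g0.
have := @ge0_integral_distribution _ _ _ _ _ P f' g mg g0 => /= <- <-.
by apply: eq_measure_integral => E mE _; exact: distrE.
Qed.

Lemma integral_equal_laws (g : T1 * T2 -> \bar R) : measurable_fun [set: T1 * T2] g ->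
  P.-integrable [set: T] (g \o f) -> P.-integrable [set: T] (g \o f') ->
  \int[P]_x g (f x) = \int[P]_x g (f' x).
Proof.
move=> mg i i'; have := @integral_distribution _ _ _ _ _ P f g mg i.
have := @integral_distribution _ _ _ _ _ P f' g mg i' => /= <- <-.
by apply: eq_measure_integral => E mE _; exact: distrE.
Qed.

End equal_laws.

Lemma measure_bigsetU_le d (T : measurableType d) (R : realType) (mu : {measure set T -> \bar R})
    (I : Type) (s : seq I) (F : I -> set T) : (forall i, measurable (F i)) ->
  (mu (\big[setU/set0]_(i <- s) F i) <= \sum_(i <- s) mu (F i))%E.
Proof.
move=> mF; elim: s => [|i s IH]; first by rewrite !big_nil measure0.
rewrite !big_cons (le_trans (measureU2 _ _ _))//; last exact: leeD.
exact: bigsetU_measurable.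
Qed.

Definition mfun_of d d' (T : measurableType d) (U : measurableType d') (f : T -> U)
  (mf : measurable_fun [set: T] f) : {mfun T >-> U} :=
  HB.pack f (isMeasurableFun.Build _ _ _ _ f mf).

Section random_vectors.
Context d (T : measurableType d) (R : realType) (P : probability T R).
Variables (p : nat).
Implicit Types (X Y : T -> 'cV[R]_p) (j l : 'I_p).

Lemma L2_vec_measurable X : L2_vec P X -> forall j, measurable_fun [set: T] (fun w => X w j 0).
Proof. by move=> L2X j; have /sub_Lfun_mfun/set_mem := L2X j. Qed.

(** One covariance entry involves only two coordinates, so the probabilistic arguments can take
    place on [R * R]. *)
Definition coord_pair X (mX : forall j, measurable_fun [set: T] (fun w => X w j 0)) j l :
  {mfun T >-> (R * R)%type} := mfun_of (measurable_fun_pair (mX j) (mX l)).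

(** The implications leave every side other than [j] and [l] unconstrained, and impose both [A] and
    [B] when [j = l]. *)
Lemma preimage_coord_pair X mX j l (A B : set R) :
  @coord_pair X mX j l @^-1` (A `*` B) =
  box_event X (fun m => [set x | (m = j -> A x) /\ (m = l -> B x)]).
Proof.
apply/seteqP; split=> w /=; first by move=> [Aw Bw] m; split=> ->.
by move=> H; split; [exact: (H j).1 | exact: (H l).2].
Qed.

Lemma measurable_pair_box j l (A B : set R) (m : 'I_p) : measurable A -> measurable B ->
  measurable [set x | (m = j -> A x) /\ (m = l -> B x)].
Proof.
move=> mA mB.
have imp (q : Prop) (E : set R) : measurable E -> measurable [set x | q -> E x].
  move=> mE; have [q1|q0] := pselect q.
    by rewrite (_ : [set x | _] = E)//; apply/seteqP; split=> x /=; tauto.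
  by rewrite (_ : [set x | _] = setT)//; apply/seteqP; split=> x /=.
by apply: measurableI; exact: imp.
Qed.

Lemma same_law_coord_pair X Y mX mY j l (A B : set R) : same_law P X Y ->
  measurable A -> measurable B ->
  P (@coord_pair X mX j l @^-1` (A `*` B)) = P (@coord_pair Y mY j l @^-1` (A `*` B)).
Proof.
move=> XY mA mB; rewrite !preimage_coord_pair; apply: XY => m.
exact: measurable_pair_box.
Qed.

Lemma independent_coord_pair n (Xs : 'I_n -> T -> 'cV[R]_p)
    (mXs : forall i j, measurable_fun [set: T] (fun w => Xs i w j 0)) j l :
  mutually_independent P Xs ->
  forall A B, (forall i, measurable (A i)) -> (forall i, measurable (B i)) ->
  P (\bigcap_(i in [set: 'I_n]) coord_pair (mXs i) j l @^-1` (A i `*` B i)) =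
  (\prod_(i < n) P (coord_pair (mXs i) j l @^-1` (A i `*` B i)))%E.
Proof.
move=> ind A B mA mB.
under eq_bigcapr do rewrite preimage_coord_pair.
under eq_bigr do rewrite preimage_coord_pair.
by apply: ind => i m; exact: measurable_pair_box.
Qed.

Lemma Lfun2_center X : L2_vec P X -> forall j,
  (fun w => X w j 0 - mean_vec P X j 0) \in Lfun P 2%:E.
Proof.
move=> L2X j; have := L2X j => L2j.
have : (fun w => X w j 0) - cst (mean_vec P X j 0) \in Lfun P 2%:E.
  by rewrite rpredB//= ?lee1n// => *; exact: Lfun_cst.
by [].
Qed.

Lemma integral_center X : L2_vec P X -> forall j,
  (\int[P]_w (X w j 0 - mean_vec P X j 0)%:E = 0)%E.
Proof.
move=> L2X j; have L1 : (fun w => X w j 0) \in Lfun P 1.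
  by apply: Lfun_subset12; rewrite ?fin_num_measure.
have iX := L1; move/Lfun1_integrable in iX.
under eq_integral do rewrite EFinB.
rewrite integralB_EFin//; last exact: finite_measure_integrable_cst.
rewrite integral_cst//= probability_setT mule1 mxE fineK ?expectation_fin_num//.
by rewrite expectation.unlock subee//; exact: (integrable_fin_num measurableT iX).
Qed.

Lemma cov_mat_integral X : L2_vec P X -> forall j l,
  P.-integrable [set: T]
    (fun w => ((X w j 0 - mean_vec P X j 0) * (X w l 0 - mean_vec P X l 0))%:E) /\
  (\int[P]_w ((X w j 0 - mean_vec P X j 0) * (X w l 0 - mean_vec P X l 0))%:E =
    (cov_mat P X j l)%:E)%E.
Proof.
move=> L2X j l.
have L1 := Lfun2_mul_Lfun1 (Lfun2_center L2X j) (Lfun2_center L2X l).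
have iYY := L1; move/Lfun1_integrable in iYY.
split=> //; rewrite [cov_mat _ _ _ _]mxE.
have -> : covariance P (fun w => X w j 0) (fun w => X w l 0) =
    (\int[P]_w ((X w j 0 - mean_vec P X j 0) * (X w l 0 - mean_vec P X l 0))%:E)%E.
  by rewrite covariance.unlock !mxE expectation.unlock; apply: eq_integral => w _.
by rewrite fineK//; apply: integrable_fin_num.
Qed.

Lemma cov_mat_sym X : (cov_mat P X)^T = cov_mat P X.
Proof. by apply/matrixP => j l; rewrite !mxE covarianceC. Qed.

End random_vectors.

(** * Exponential moments of sub-Gaussian coordinates and of their products *)

Section subgaussian_vector.
Context d (T : measurableType d) (R : realType) (P : probability T R).
Variables (p : nat) (X : T -> 'cV[R]_p) (K C l1 : R).
Hypotheses (K0 : 0 < K) (C0 : 0 < C) (l1_gt0 : 0 < l1) (L2X : L2_vec P X).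
Hypothesis subG : forall (v : 'cV[R]_p) (t : R), v != 0 -> 0 < t ->
  (P [set w | (t <= `|(v^T *m (X w - mean_vec P X)) 0 0|)%R]
    <= ((K * expR (- (C * t ^+ 2) / (v^T *m cov_mat P X *m v) 0 0))%R)%:E)%E.
Hypothesis diag_le : forall j, cov_mat P X j j <= l1.

Local Notation Y := (fun w (j : 'I_p) => X w j 0 - mean_vec P X j 0).
(** Half of the sub-Gaussian rate [C / l1], so that the event [m <= a * Y ^+ 2] has tail
    [K * expR (- (2 * m))]. *)
Local Notation a := (C / (2 * l1)).

Let a0 : 0 < a. Proof. by rewrite divr_gt0// mulr_gt0. Qed.

Let mX := L2_vec_measurable L2X.

Lemma measurable_center j : measurable_fun [set: T] (fun w => Y w j).
Proof. by apply: measurable_funB => //; exact: measurable_cst. Qed.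

Lemma cov_mat_diag_ge0 j : 0 <= cov_mat P X j j.
Proof. by rewrite mxE fine_ge0// variance_ge0. Qed.

Lemma center_tail j t : 0 < t ->
  (P [set w | (t <= `|Y w j|)%R] <= (K * expR (- (C * t ^+ 2) / l1))%:E)%E.
Proof.
move=> t0.
(* At zero variance the exponent in [subG] is a division by zero, with value 0, and gives no decay.
   Chebyshev's inequality shows instead that the event is null. *)
have [s0|s0] := leP (cov_mat P X j j) 0.
  pose Xj : {RV P >-> R} := mfun_of (mX j).
  have := @chebyshev _ _ _ P Xj t t0.
  have V0 : 'V_P[Xj]%E = 0%E.
    have [_] := cov_mat_integral L2X j j.
    rewrite (_ : cov_mat P X j j = 0); last by apply/eqP; rewrite eq_le s0 cov_mat_diag_ge0.
    apply: etrans; rewrite /variance covariance.unlock !mxE expectation.unlock.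
    by apply: eq_integral => w _.
  rewrite V0 mule0; set E := [set _ | _]; have -> : E = [set w | t <= `|Y w j|].
    by rewrite /E; apply/seteqP; split=> w /=; rewrite !mxE.
  by move=> /le_trans; apply; rewrite lee_fin mulr_ge0 ?expR_ge0// ltW.
have v0 : delta_mx j 0 != 0 :> 'cV[R]_p.
  by apply/eqP => /matrixP/(_ j 0); rewrite !mxE !eqxx => /eqP; rewrite oner_eq0.
have := subG v0 t0.
have -> : ((delta_mx j 0 : 'cV[R]_p)^T *m cov_mat P X *m (delta_mx j 0 : 'cV[R]_p)) 0 0 =
    cov_mat P X j j.
  by rewrite trmx_delta -(rowE j (cov_mat P X)) -(colE j) !mxE.
have -> : [set w | t <= `|((delta_mx j 0 : 'cV[R]_p)^T *m (X w - mean_vec P X)) 0 0|] =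
    [set w | t <= `|Y w j|].
  by apply/seteqP; split=> w /=; rewrite trmx_delta -(rowE j (X w - mean_vec P X)) !mxE.
move=> /le_trans; apply; rewrite lee_fin ler_pM2l// ler_expR.
have Ct : 0 < C * t ^+ 2 by rewrite mulr_gt0 ?exprn_gt0.
by rewrite !mulNr lerN2 ler_pM2l// lef_pV2 ?posrE.
Qed.

(** The tail at [t = Num.sqrt (m / a)] is exactly the hypothesis of [integral_expR_tail] for
    [a * Y ^+ 2]. *)
Lemma center_expR_moment j :
  (\int[P]_w (expR (a * Y w j ^+ 2))%:E <= (2 * expR 1 * (1 + K))%:E)%E.
Proof.
apply: integral_expR_tail; last 3 first.
- by move=> w; rewrite mulr_ge0 ?sqr_ge0// ltW.
- exact: ltW.
- move=> m m0; have ma0 : 0 < m%:R / a by rewrite divr_gt0// ltr0n.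
  have t0 : 0 < Num.sqrt (m%:R / a) by rewrite sqrtr_gt0.
  have := center_tail j t0; rewrite sqr_sqrtr ?(ltW ma0)//.
  have -> : - (C * (m%:R / a)) / l1 = - (2 * m%:R).
    by field; rewrite !gt_eqF.
  have sqrE w : (Num.sqrt (m%:R / a) <= `|Y w j|) = (m%:R <= a * Y w j ^+ 2).
    rewrite -ler_sqr ?nnegrE ?sqrtr_ge0// sqr_sqrtr ?(ltW ma0)// real_normK ?num_real//.
    by rewrite ler_pdivrMr// mulrC.
  rewrite (_ : [set w | _] = [set w | m%:R <= a * Y w j ^+ 2])//.
  by apply/seteqP; split=> w /=; rewrite sqrE.
- apply: measurable_funM; first exact: measurable_cst.
  exact/measurable_funX/measurable_center.
Qed.

(** Integrate the inequality between a product and the mean of the squares, then use the diagonal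
    bound. *)
Lemma cov_mat_abs_le j l : `|cov_mat P X j l| <= l1.
Proof.
have [iY YE] := cov_mat_integral L2X j l.
have [ij jE] := cov_mat_integral L2X j j.
have [il lE] := cov_mat_integral L2X l l.
rewrite -lee_fin -[leLHS]abse_EFin -YE.
apply: (le_trans (le_abse_integral P measurableT (measurable_int _ iY))).
apply: (@le_trans _ _ (\int[P]_w ((2^-1)%:E * ((Y w j * Y w j)%:E + (Y w l * Y w l)%:E)))%E).
  apply: ge0_le_integral => //.
  - apply: measurableT_comp => //; exact: measurable_int iY.
  - apply: emeasurable_funM => //.
    by apply: emeasurable_funD; [exact: measurable_int ij|exact: measurable_int il].
  move=> w _ /=; rewrite lee_fin normrM.
  have := sqr_ge0 (`|Y w j| - `|Y w l|); rewrite -!expr2.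
  rewrite -(real_normK (num_real (Y w j))) -(real_normK (num_real (Y w l))) !expr2; lra.
rewrite integralZl//; last exact: integrableD.
rewrite integralD// jE lE lee_fin; have := diag_le j; have := diag_le l; lra.
Qed.

Let B0 : R := 2 * expR 1 * (1 + K).

(** The exponent is an average so that one lemma serves both products [Y_j Y_l] and, with [j = l],
    single coordinates. *)
Lemma integral_le_center_moment (h : T -> R) (D : R) j l : measurable_fun [set: T] h ->
  (forall w, 0 <= h w) -> 0 <= D ->
  (forall w, h w <= D * expR ((a * Y w j ^+ 2 + a * Y w l ^+ 2) / 2)) ->
  (\int[P]_w (h w)%:E <= (D * B0)%:E)%E.
Proof.
move=> mh h0 D0 hD.
have mexp m : measurable_fun [set: T] (fun w => (expR (a * Y w m ^+ 2))%:E).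
  have mY : measurable_fun [set: T] (fun w => a * Y w m ^+ 2).
    apply: measurable_funM; first exact: measurable_cst.
    exact/measurable_funX/measurable_center.
  by apply/measurable_EFinP; exact: (measurableT_comp (@measurable_expR R) mY).
have exp0 m w : (0 <= (expR (a * Y w m ^+ 2))%:E)%E by rewrite lee_fin expR_ge0.
apply: (@le_trans _ _ (\int[P]_w ((D / 2)%:E *
    ((expR (a * Y w j ^+ 2))%:E + (expR (a * Y w l ^+ 2))%:E)))%E).
  apply: ge0_le_integral => //.
  - by move=> w _; rewrite lee_fin.
  - exact/measurable_EFinP.
  - by apply: emeasurable_funM => //; apply: emeasurable_funD.
  move=> w _; rewrite -EFinD -EFinM lee_fin (le_trans (hD w))// -[leRHS]mulrA ler_wpM2l//.
  (* AM-GM *)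
  rewrite mulrDl expRD.
  have half (z : R) : expR z = expR (z / 2) ^+ 2 by rewrite expr2 -expRD -splitr.
  rewrite [in leRHS](half (a * Y w j ^+ 2)) [in leRHS](half (a * Y w l ^+ 2)).
  have := sqr_ge0 (expR (a * Y w j ^+ 2 / 2) - expR (a * Y w l ^+ 2 / 2)).
  by rewrite !expr2; lra.
rewrite ge0_integralZl//; last 3 first.
- exact: emeasurable_funD.
- by move=> w _; rewrite adde_ge0.
- by rewrite lee_fin divr_ge0.
rewrite ge0_integralD//.
apply: (@le_trans _ _ ((D / 2)%:E * (B0%:E + B0%:E))%E).
  by apply: lee_wpmul2l; [rewrite lee_fin divr_ge0|apply: leeD; exact: center_expR_moment].
by rewrite -EFinD -EFinM lee_fin le_eqVlt; apply/orP; left; apply/eqP; field.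
Qed.

Definition centered_prod j l (y : R * R) : R :=
  a * ((y.1 - mean_vec P X j 0) * (y.2 - mean_vec P X l 0) - cov_mat P X j l).

(** Although it reads one component, it is defined on pairs in order to share the tail bound of
    [centered_prod]. The scale is [Num.sqrt a] because its square is compared with [a * Y ^+ 2]. *)
Definition centered_coord j (y : R * R) : R := Num.sqrt a * (y.1 - mean_vec P X j 0).

Lemma measurable_centered_coord j : measurable_fun [set: R * R] (centered_coord j).
Proof.
apply: measurable_funM; first exact: measurable_cst.
by apply: measurable_funB; [exact: measurable_fst | exact: measurable_cst].
Qed.

Lemma measurable_centered_prod j l : measurable_fun [set: R * R] (centered_prod j l).
Proof.
apply: measurable_funM; first exact: measurable_cst.
apply: measurable_funB; last exact: measurable_cst.
apply: measurable_funM; apply: measurable_funB; try exact: measurable_cst.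
  exact: measurable_fst.
exact: measurable_snd.
Qed.

(** A common bound for both families, depending on [K] and [C] only: [C / 2 = a * l1] absorbs the
    subtracted covariance in [centered_prod], and the 1 comes from [z <= z ^+ 2 + 1] for
    [centered_coord]. *)
Definition moment_bound : R := expR (C / 2 + 1) * B0.

Lemma integral_centered_coord j l :
  (\int[P]_w (centered_coord j (coord_pair mX j l w))%:E = 0)%E.
Proof.
rewrite /centered_coord /=; under eq_integral do rewrite EFinM.
have iY : P.-integrable [set: T] (fun w => (Y w j)%:E).
  by apply/Lfun1_integrable; apply: Lfun_subset12; rewrite ?fin_num_measure//; exact: Lfun2_center.
by rewrite integralZl// integral_center// mule0.
Qed.

Lemma integral_centered_prod j l :
  (\int[P]_w (centered_prod j l (coord_pair mX j l w))%:E = 0)%E.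
Proof.
rewrite /centered_prod /=; under eq_integral do rewrite EFinM EFinB.
have [iY YE] := cov_mat_integral L2X j l.
have ic : P.-integrable [set: T] (EFin \o cst (cov_mat P X j l)).
  exact: finite_measure_integrable_cst.
rewrite integralZl//; last exact: (integrableB measurableT iY ic).
by rewrite integralB_EFin// YE integral_cst//= probability_setT mule1 subee// mule0.
Qed.

Let B0_ge0 : 0 <= B0.
Proof. by rewrite !mulr_ge0 ?expR_ge0// addr_ge0// ltW. Qed.

Lemma centered_coord_expR_moment j l :
  (\int[P]_w (expR `|centered_coord j (coord_pair mX j l w)|)%:E <= moment_bound%:E)%E.
Proof.
apply: (@le_trans _ _ ((expR 1 * B0)%:E)); last first.
  by rewrite lee_fin ler_wpM2r// ler_expR lerDr divr_ge0// ltW.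
apply: (@integral_le_center_moment _ _ j j).
- apply: (measurableT_comp (@measurable_expR R)); apply: measurableT_comp => //.
  exact: (measurableT_comp (measurable_centered_coord j)).
- by move=> w; rewrite expR_ge0.
- exact: expR_ge0.
- move=> w; rewrite -expRD ler_expR /centered_coord/=.
  have -> : a * Y w j ^+ 2 = `|Num.sqrt a * Y w j| ^+ 2.
    by rewrite real_normK ?num_real// exprMn sqr_sqrtr// ltW.
  set z := `|_|; have := sqr_ge0 (z - 1); have := sqr_ge0 z; rewrite !expr2; nra.
Qed.

Lemma centered_prod_expR_moment j l :
  (\int[P]_w (expR `|centered_prod j l (coord_pair mX j l w)|)%:E <= moment_bound%:E)%E.
Proof.
apply: (@le_trans _ _ ((expR (C / 2) * B0)%:E)); last first.
  by rewrite lee_fin ler_wpM2r// ler_expR lerDl.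
apply: (@integral_le_center_moment _ _ j l).
- apply: (measurableT_comp (@measurable_expR R)); apply: measurableT_comp => //.
  exact: (measurableT_comp (measurable_centered_prod j l)).
- by move=> w; rewrite expR_ge0.
- exact: expR_ge0.
- move=> w; rewrite -expRD ler_expR /centered_prod/=.
  rewrite normrM (gtr0_norm a0) -mulrDr -mulrA.
  have -> : C / 2 = a * l1 by field; rewrite gt_eqF.
  rewrite -mulrDr ler_pM2l// (le_trans (ler_normB _ _))// addrC lerD ?cov_mat_abs_le// normrM.
  have := sqr_ge0 (`|Y w j| - `|Y w l|).
  rewrite -(real_normK (num_real (Y w j))) -(real_normK (num_real (Y w l))) !expr2; lra.
Qed.

(** * Concentration of the entries of the sample covariance *)

Section sample.
Variables (n : nat) (Xs : 'I_n -> T -> 'cV[R]_p).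
Hypothesis mXs : forall i j, measurable_fun [set: T] (fun w => Xs i w j 0).
Hypotheses (law : forall i, same_law P (Xs i) X) (ind : mutually_independent P Xs).

(** Equality of laws transfers the moment conditions from [X] to every [Xs i], after which
    [sum_tail] applies. *)
Lemma sample_tail j l (g : R * R -> R) (B u : R) : measurable_fun [set: R * R] g ->
  (\int[P]_w (g (coord_pair mX j l w))%:E = 0)%E ->
  (\int[P]_w (expR `|g (coord_pair mX j l w)|)%:E <= B%:E)%E ->
  0 <= u -> u <= 1 ->
  (P [set w | (n%:R * (4 * B + 10) * u <= `|\sum_(i < n) g (Xs i w j 0, Xs i w l 0)|)%R] <=
    (2 * expR (- (5 * (n%:R * u ^+ 2))))%:E)%E.
Proof.
move=> mg g0 gB u0 u1.
have lawE i A B' : measurable A -> measurable B' ->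
    P (coord_pair (mXs i) j l @^-1` (A `*` B')) = P (coord_pair mX j l @^-1` (A `*` B')).
  by move=> mA mB; exact: same_law_coord_pair.
have mexp : measurable_fun [set: R * R] (fun y => (expR `|g y|)%:E).
  apply/measurable_EFinP; apply: (measurableT_comp (@measurable_expR R)).
  exact: measurableT_comp.
have gBs i : (\int[P]_w (expR `|g (coord_pair (mXs i) j l w)|)%:E <= B%:E)%E.
  by rewrite (ge0_integral_equal_laws (lawE i) (g := fun y => (expR `|g y|)%:E)).
have mgX Z mZ : measurable_fun [set: T] (fun w => g (@coord_pair _ _ _ _ Z mZ j l w)).
  exact: (measurableT_comp mg).
apply: (sum_tail (independent_coord_pair mXs j l ind)) => // i.
rewrite (integral_equal_laws (lawE i) (g := fun y => (g y)%:E))//.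
- exact/measurable_EFinP.
- exact: (integrable_of_expR_norm (mgX _ _) (gBs i)).2.
- exact: (integrable_of_expR_norm (mgX _ _) gB).2.
Qed.

(** By [sample_covE] the error is a centered average of products, at most [tau * u / a], minus a
    product of two averages, at most [tau ^+ 2 * u ^+ 2 / a]; [u <= 1] makes the latter linear in
    [u], and [2 * l1 / C] is [a^-1]. *)
Lemma sample_cov_entry_le w j l (tau u : R) : (0 < n)%N -> 0 <= u -> u <= 1 ->
  `|\sum_(i < n) centered_prod j l (Xs i w j 0, Xs i w l 0)| <= n%:R * tau * u ->
  `|\sum_(i < n) centered_coord j (Xs i w j 0, Xs i w j 0)| <= n%:R * tau * u ->
  `|\sum_(i < n) centered_coord l (Xs i w l 0, Xs i w l 0)| <= n%:R * tau * u ->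
  `|(sample_cov (fun i => Xs i w) - cov_mat P X) j l| <= 2 * l1 / C * (tau + tau ^+ 2) * u.
Proof.
move=> n0 u0 u1 prod_le coordj_le coordl_le.
have n0' : 0 < n%:R :> R by rewrite ltr0n.
have sa0 : 0 < Num.sqrt a by rewrite sqrtr_gt0.
have tau0 : 0 <= tau * u by rewrite -(pmulr_rge0 _ n0') mulrA (le_trans _ prod_le).
pose ybar m := n%:R^-1 * \sum_i (Xs i w m 0 - mean_vec P X m 0).
have ybar_le m : `|\sum_(i < n) centered_coord m (Xs i w m 0, Xs i w m 0)| <= n%:R * tau * u ->
    `|ybar m| <= tau * u / Num.sqrt a.
  rewrite /centered_coord -mulr_sumr normrM (gtr0_norm sa0) => H.
  rewrite ler_pdivlMr// mulrC /ybar normrM normfV (gtr0_norm n0') mulrCA.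
  by rewrite ler_pdivrMl// mulrA.
have Aj := ybar_le _ coordj_le; have Al := ybar_le _ coordl_le.
have yy_le : `|ybar j * ybar l| <= tau ^+ 2 * u / a.
  rewrite normrM; apply: (@le_trans _ _ ((tau * u / Num.sqrt a) * (tau * u / Num.sqrt a))).
    exact: ler_pM.
  rewrite mulrACA -invfM -expr2 -expr2 sqr_sqrtr ?(ltW a0)// ler_pM2r ?invr_gt0// exprMn.
  by rewrite ler_wpM2l ?sqr_ge0// expr2 ler_piMr.
have prod_le' : `|n%:R^-1 *
    (\sum_i (Xs i w j 0 - mean_vec P X j 0) * (Xs i w l 0 - mean_vec P X l 0))
    - cov_mat P X j l| <= tau * u / a.
  move: prod_le; rewrite /centered_prod -mulr_sumr sumrB sumr_const card_ord.
  rewrite -(mulr_natl (cov_mat _ _ _ _)); set S := \sum_(i < n) _ => H.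
  rewrite ler_pdivlMr//.
  have -> : n%:R^-1 * S - cov_mat P X j l = n%:R^-1 * (S - n%:R * cov_mat P X j l).
    by rewrite mulrBr mulKf// gt_eqF.
  rewrite mulrC normrM normfV (gtr0_norm n0') mulrCA ler_pdivrMl// mulrA.
  by move: H; rewrite normrM (gtr0_norm a0).
rewrite mxE [(- cov_mat _ _) _ _]mxE (sample_covE _ (mean_vec P X))// addrAC.
have -> : 2 * l1 / C * (tau + tau ^+ 2) * u = tau * u / a + tau ^+ 2 * u / a.
  by field; rewrite !gt_eqF.
by apply: (le_trans (ler_normB _ _)); exact: lerD.
Qed.

Lemma sample_cov_deviation : (1 < p)%N -> (0 < n)%N -> ln (p%:R : R) <= n%:R ->
  let tau := 4 * moment_bound + 10 in
  exists A : set T, [/\ measurable A, ((1 - 2 / p%:R ^+ 2 : R)%:E <= P A)%E &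
    forall w, A w -> forall j l,
    `|(sample_cov (fun i => Xs i w) - cov_mat P X) j l| <=
      2 * l1 / C * (tau + tau ^+ 2) * Num.sqrt (ln (p%:R : R) / n%:R)].
Proof.
move=> p1 n0 lnp tau; set u := Num.sqrt _.
have p0 : 0 < p%:R :> R by rewrite ltr0n (ltn_trans _ p1).
have n0' : 0 < n%:R :> R by rewrite ltr0n.
have lnp0 : 0 <= ln (p%:R : R) by rewrite ln_ge0// ler1n (ltn_trans _ p1).
have u0 : 0 <= u by exact: sqrtr_ge0.
have u1 : u <= 1 by rewrite -sqrtr1 ler_psqrt ?nnegrE ?divr_ge0 ?(ltW n0')// ler_pdivrMr// mul1r.
have nu2 : n%:R * u ^+ 2 = ln (p%:R : R).
  by rewrite sqr_sqrtr ?divr_ge0 ?(ltW n0')// mulrC divfK// gt_eqF.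
have tailE : expR (- (5 * (n%:R * u ^+ 2))) = p%:R ^- 5 :> R.
  by rewrite nu2 expRN expRM_natl lnK.
pose Ep jl := [set w | n%:R * tau * u <=
  `|\sum_(i < n) centered_prod jl.1 jl.2 (Xs i w jl.1 0, Xs i w jl.2 0)|].
(* Indexed by pairs, though it depends on the first index only, so that a single union covers both
   kinds of events. *)
pose Ec (jl : 'I_p * 'I_p) := [set w | n%:R * tau * u <=
  `|\sum_(i < n) centered_coord jl.1 (Xs i w jl.1 0, Xs i w jl.1 0)|].
have mge (h : T -> R) (r : R) : measurable_fun [set: T] h -> measurable [set w | r <= `|h w|].
  move=> mh; rewrite -[X in measurable X]setTI.
  by apply: measurable_fun_ler; [exact: measurable_cst | exact: measurableT_comp|..].
have msample (g : R * R -> R) j l : measurable_fun [set: R * R] g ->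
    measurable_fun [set: T] (fun w => \sum_(i < n) g (Xs i w j 0, Xs i w l 0)).
  move=> mg; apply: measurable_sum => i.
  exact: (measurableT_comp mg (measurable_fun_pair (mXs i j) (mXs i l))).
have mEp jl : measurable (Ep jl) by apply/mge/msample; exact: measurable_centered_prod.
have mEc jl : measurable (Ec jl) by apply/mge/msample; exact: measurable_centered_coord.
have mE jl : measurable (Ep jl `|` Ec jl) by exact: measurableU.
pose bad := \big[setU/set0]_(jl : 'I_p * 'I_p) (Ep jl `|` Ec jl).
have mbad : measurable bad by exact: bigsetU_measurable.
have Pbad : (P bad <= (2 / p%:R ^+ 2 : R)%:E)%E.
  apply: (le_trans (measure_bigsetU_le P _ mE)).
  apply: (@le_trans _ _ (\sum_(jl : 'I_p * 'I_p) (4 * p%:R ^- 5)%:E)%E).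
    apply: lee_sum => jl _; apply: (le_trans (measureU2 P (mEp jl) (mEc jl))).
    have -> : 4 * p%:R ^- 5 = 2 * p%:R ^- 5 + 2 * p%:R ^- 5 :> R by rewrite -mulrDl -natrD.
    rewrite -tailE EFinD; apply: leeD.
      apply: sample_tail => //; first exact: measurable_centered_prod.
        exact: integral_centered_prod.
      exact: centered_prod_expR_moment.
    apply: sample_tail => //; first exact: measurable_centered_coord.
      exact: integral_centered_coord.
    exact: centered_coord_expR_moment.
  rewrite sumEFin lee_fin sumr_const card_prod card_ord.
  (* The [p ^ 2] pairs contribute [4 * p ^- 5] each, and [4 / p <= 2] because [p] is at least 2. *)
  have -> : (4 * p%:R ^- 5) *+ (p * p) = 4 / p%:R / p%:R ^+ 2 :> R.
    by rewrite -(mulr_natr (4 * _)) natrM; field; rewrite gt_eqF.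
  rewrite ler_pM2r ?invr_gt0 ?exprn_gt0// ler_pdivrMr//.
  by have : (2 : R) <= p%:R by [rewrite ler_nat]; lra.
exists (~` bad); split; first exact: measurableC.
  rewrite probability_setC// EFinB; apply: leeB => //.
move=> w nbad j l.
have good jl : ~ Ep jl w /\ ~ Ec jl w.
  by split=> E; apply: nbad; rewrite /bad (bigD1 jl)//=; left; [left|right].
have ltE (r s : R) : ~ (r <= s) -> s <= r by move=> /negP; rewrite -ltNge => /ltW.
by apply: sample_cov_entry_le => //; apply: ltE;
  [exact: (good (j, l)).1 | exact: (good (j, l)).2 | exact: (good (l, l)).2].
Qed.

End sample.

End subgaussian_vector.

(** * Near-optimality of the empirical maximiser *)

Theorem theorem3 (R : realType) (K C : R) :
  0 < K -> 0 < C ->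
  exists c : R, 0 < c /\
  forall (d : measure_display) (T : measurableType d) (P : probability T R)
         (p n k : nat) (X : T -> 'cV[R]_p) (Xs : 'I_n -> T -> 'cV[R]_p)
         (l1 Rad : R) (HR : 'M[R]_p) (Hhat : T -> 'M[R]_p),
    (* i.i.d. sample with the law of X, finite second moments *)
    L2_vec P X ->
    (forall i, L2_vec P (Xs i)) ->
    (forall i, same_law P (Xs i) X) ->
    mutually_independent P Xs ->
    (* sub-Gaussian condition *)
    (forall (v : 'cV[R]_p) (t : R), v != 0 -> 0 < t ->
       (P [set w | (t <= `|(v^T *m (X w - mean_vec P X)) 0 0|)%R]
        <= ((K * expR (- (C * t ^+ 2) / (v^T *m cov_mat P X *m v) 0 0))%R)%:E)%E) ->
    (* l1 is the largest eigenvalue of Sigma *)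
    eigenvalue (cov_mat P X) l1 ->
    (forall a, eigenvalue (cov_mat P X) a -> a <= l1) ->
    (0 < n)%N ->
    ln (p%:R : R) <= n%:R ->
    (1 <= k <= p)%N -> 0 < Rad ->
    is_argmax k Rad (cov_mat P X) HR ->
    (forall w, is_argmax k Rad (sample_cov (fun i => Xs i w)) (Hhat w)) ->
    exists A : set T, measurable A /\
      (((1 - 2 / (p%:R ^+ 2)) : R)%:E <= P A)%E /\
      forall w, A w ->
        frob (cov_mat P X) (Hhat w) <= frob (cov_mat P X) HR /\
        frob (cov_mat P X) HR - c * Rad * l1 * Num.sqrt (ln (p%:R : R) / n%:R)
          <= frob (cov_mat P X) (Hhat w).
Proof.
move=> K0 C0; pose tau := 4 * moment_bound K C + 10.
have tau0 : 0 < tau.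
  by rewrite ltr_wpDl// !mulr_ge0 ?expR_ge0// addr_ge0// ltW.
have tau20 : 0 < tau + tau ^+ 2 by rewrite addr_gt0// exprn_gt0.
(* Twice the constant of the entrywise deviation with [l1] taken out; it depends on [K] and [C]
   only. *)
exists (4 / C * (tau + tau ^+ 2)); split; first by rewrite !mulr_gt0 ?invr_gt0.
move=> d T P p n k X Xs l1 Rad HR Hhat L2X L2Xs law ind subG _ l1_max n0 lnp /andP[k1 kp] Rad0
  maxHR maxHhat.
have upper w : frob (cov_mat P X) (Hhat w) <= frob (cov_mat P X) HR.
  by apply: maxHR.2; exact: (maxHhat w).1.
have p0 : (0 < p)%N by exact: leq_trans k1 kp.
have [p1|p1] := leqP p 1.
  (* For [p = 1] the claimed probability bound is negative. *)
  exists set0; split=> //; split=> //; rewrite measure0 lee_fin.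
  by rewrite (_ : p = 1%N) ?expr1n; [lra | apply/eqP; rewrite eqn_leq p1 p0].
have diag_le := diag_le_eigenvalue (cov_mat_sym P X) l1_max.
have l1_ge0 : 0 <= l1 by apply: le_trans (diag_le (Ordinal p0)); exact: cov_mat_diag_ge0.
(* The scale [C / (2 * l1)] needs [l1 > 0]. If [l1 = 0], the covariance matrix vanishes and both
   inequalities hold everywhere. *)
have [l1_le0|l1_gt0] := leP l1 0.
  have l1E : l1 = 0 by apply/eqP; rewrite eq_le l1_le0.
  have cov0 H : frob (cov_mat P X) H = 0.
    apply/eqP; rewrite -normr_le0 -(mul0r (norm11 H)); apply: frob_le => i j.
    by rewrite -l1E; exact: cov_mat_abs_le.
  exists setT; split=> //; split=> [|w _]; last by rewrite !cov0 l1E mulr0 mul0r subrr.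
  by rewrite probability_setT lee_fin gerBl divr_ge0// exprn_ge0.
have mXs i : forall j, measurable_fun [set: T] (fun w => Xs i w j 0).
  exact: L2_vec_measurable (L2Xs i).
have [A [mA PA devA]] :=
  sample_cov_deviation K0 C0 l1_gt0 L2X subG diag_le mXs law ind p1 n0 lnp.
exists A; split=> //; split=> // w Aw; split=> //.
have e0 : 0 <= 2 * l1 / C * (tau + tau ^+ 2) * Num.sqrt (ln (p%:R : R) / n%:R).
  by rewrite !mulr_ge0 ?sqrtr_ge0 ?invr_ge0 ?(ltW tau20) ?(ltW C0) ?(ltW l1_gt0).
have := argmax_perturbation e0 (devA w Aw) maxHR (maxHhat w).
congr (_ - _ <= _); field; rewrite gt_eqF//.
Qed.
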